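(* Let $\Gamma$ be a finitely generated group and $\varphi \colon \Gamma \to \Gamma$ a renormalization of $\Gamma$. Let $\mathfrak{G}$ be the profinite completion of $\Gamma$. Then the profinite action $\widehat{\Phi}_{\mathfrak{G}} \colon \mathfrak{G} \times X_{\varphi} \to X_{\varphi}$ is quasi-analytic.
   Context: A renormalization of a countable group $\Gamma$ is an injective homomorphism $\varphi\colon\Gamma\to\Gamma$ whose image is a proper subgroup of finite index. Put $\Gamma_0=\Gamma$, $\Gamma_\ell=\varphi^\ell(\Gamma)$, $X_\ell=\Gamma/\Gamma_\ell$ (left cosets), and let $X_\varphi=\varprojlim X_\ell$ be the inverse limit under the natural quotient maps $X_{\ell+1}\to X_\ell$; it is a Cantor space. The left translation actions of $\Gamma$ on the $X_\ell$ induce a minimal equicontinuous action $\Phi_\varphi\colon\Gamma\to\mathrm{Homeo}(X_\varphi)$. Let $\widehat{\Gamma}_\varphi$ be the closure of $\Phi_\varphi(\Gamma)$ in $\mathrm{Homeo}(X_\varphi)$ in the uniform topology; it is a profinite group. By the universal property of the profinite completion, $\Phi_\varphi$ induces a continuous surjective homomorphism $\Pi_\varphi\colon\mathfrak{G}\to\widehat\Gamma_\varphi\subset\mathrm{Homeo}(X_\varphi)$, and $\widehat\Phi_{\mathfrak{G}}$ denotes the resulting action of $\mathfrak{G}$ on $X_\varphi$. An action $\Phi\colon H\times\mathfrak{X}\to\mathfrak{X}$ of a topological group $H$ on a Cantor space $\mathfrak{X}$ is quasi-analytic if for each non-empty clopen set $U\subset\mathfrak{X}$ and each $g\in H$ with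 $\Phi(g)(U)=U$ and $\Phi(g)|U$ the identity map of $U$, the map $\Phi(g)$ is the identity on all of $\mathfrak{X}$. *)

(* Defs.v *)
From HB Require Import structures.
From mathcomp Require Import all_boot finmap.
From mathcomp Require Import all_classical topology.

Set Implicit Arguments.
Unset Strict Implicit.
Unset Printing Implicit Defensive.
Set Warnings "-redundant-canonical-projection".

Local Open Scope classical_set_scope.
Local Open Scope group_scope.

Section DiscreteProduct.
Context {I : choiceType} {T : I -> choiceType}.
Let P := prod_topology (fun i => discrete_topology (T i)).

Lemma discrete_prod_entourage (E : set (P * P)) : entourage E ->
  exists2 s : set I, finite_set s & forall x y : P,
    (forall i, s i -> x i = y i) -> E (x, y).
Proof.
move=> [B [F _ <-] BE].
exists [set (sval p).1 | p in [set` F]]; first exact/finite_image/finite_fset.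
move=> x y xy; apply: BE => p /= pF.
have {pF xy} := xy _ (imageP (fun p => (sval p).1 : I) pF).
case: p => -[i A]/= /asboolP[D]/=; rewrite uniform_discrete => dD DA xyi.
by apply: DA => /=; apply: dD; exists (x i) => //=; congr (_, _); exact: xyi.
Qed.

Lemma discrete_prod_coord_entourage (i : I) :
  entourage [set xy : P * P | xy.1 i = xy.2 i].
Proof.
have Di : @entourage (initial_topology (@proj I (fun i => discrete_topology (T i)) i))
  [set xy : P * P | xy.1 i = xy.2 i].
  exists [set xy | xy.1 = xy.2]; last by [].
  by rewrite uniform_discrete => _ [z _ <-].
exists [set xy : P * P | xy.1 i = xy.2 i] => //.
apply: (@finI_from1 _ _ _ _ (exist _ (i : {classic I}, _) _)) => //.
exact: asboolT Di.
Qed.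

Variable S : set P.

Lemma discrete_sub_entourage (E : set (S * S)) : entourage E ->
  exists2 s : set I, finite_set s & forall x y : S,
    (forall i, s i -> val x i = val y i) -> E (x, y).
Proof.
move=> [D /discrete_prod_entourage[s fs sD] DE]; exists s => // x y xy.
by apply: DE; exact: sD.
Qed.

Lemma discrete_sub_coord_entourage (i : I) :
  entourage [set xy : S * S | val xy.1 i = val xy.2 i].
Proof.
exists [set xy : P * P | xy.1 i = xy.2 i] => //.
exact: discrete_prod_coord_entourage.
Qed.

Lemma discrete_sub_nbhs (x : S) (U : set S) : nbhs x U ->
  exists2 s : set I, finite_set s & forall y : S,
    (forall i, s i -> val y i = val x i) -> U y.
Proof.
rewrite -nbhs_entourageE => -[E /discrete_sub_entourage[s fs sE] EU].
exists s => // y xy; apply: EU; apply/xsectionP; apply: sE => i /xy.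
by [].
Qed.

Lemma discrete_sub_coord_nbhs (x : S) (i : I) :
  nbhs x [set y : S | val y i = val x i].
Proof.
rewrite -nbhs_entourageE; exists [set xy : S * S | val xy.1 i = val xy.2 i].
  exact: discrete_sub_coord_entourage.
by move=> y /xsectionP.
Qed.

End DiscreteProduct.

Section Subsets.
Context {G : groupType}.
Implicit Types (A B C H N : set G) (g x y : G).

Definition mulset A B : set G := [set x * y | x in A & y in B].
Definition invset A : set G := [set x^-1 | x in A].

Definition subgroup H :=
  [/\ H 1, forall x y, H x -> H y -> H (x * y) & forall x, H x -> H x^-1].

Definition normal_subgroup N := subgroup N /\ forall x g, N x -> N (x ^ g).

Definition lcoset g H : set G := mulset [set g] H.
Definition lcosets H : set (set G) := range (lcoset^~ H).

Definition finite_index H := finite_set (lcosets H).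

Lemma mulsetA : associative mulset.
Proof.
move=> A B C; apply/seteqP; split => z.
  by case=> x Ax [_ [y By [t Ct <-]] <-]; exists (x * y);
    [exists x => //; exists y|exists t => //; rewrite mulgA].
case=> _ [x Ax [y By <-]] [t Ct <-]; exists x => //; exists (y * t).
  by exists y => //; exists t.
by rewrite mulgA.
Qed.

Lemma mulset1 x y : mulset [set x] [set y] = [set x * y].
Proof.
apply/seteqP; split => z /=; first by case=> _ -> [_ -> <-].
by move=> ->; exists x => //; exists y.
Qed.

Lemma lcosetE g H : lcoset g H = [set z | H (g^-1 * z)].
Proof.
apply/seteqP; split => z /=.
  by case=> _ -> [h Hh <-]; rewrite mulKg.
by move=> Hz; exists g => //; exists (g^-1 * z) => //; rewrite mulVKg.
Qed.

Lemma lcoset1 H : lcoset 1 H = H.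
Proof. by rewrite lcosetE; apply/seteqP; split => z /=; rewrite invg1 mul1g. Qed.

Lemma mulset_lcosets x A H : lcosets H A -> lcosets H (mulset [set x] A).
Proof. by case=> g _ <-; exists (x * g) => //; rewrite /lcoset mulsetA mulset1. Qed.

Lemma mulsubK H K : subgroup K -> H 1 -> H `<=` K -> mulset H K = K.
Proof.
move=> [K1 KM _] H1 HK; apply/seteqP; split => z.
  by case=> x /HK Kx [y Ky <-]; exact: KM.
by move=> Kz; exists 1 => //; exists z => //; rewrite mul1g.
Qed.

Lemma lcoset_eq x y H : subgroup H -> (lcoset x H = lcoset y H) <-> H (x^-1 * y).
Proof.
move=> [H1 HM HV]; split => [E|Hxy].
  have : lcoset y H y by rewrite lcosetE /= mulVg.
  by rewrite -E lcosetE.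
rewrite !lcosetE; apply/seteqP; split => z /=.
  by move=> /(HM _ _ (HV _ Hxy)); rewrite invgM invgK mulgA mulgK.
by move=> /(HM _ _ Hxy); rewrite mulgA mulgK.
Qed.

Lemma normal_mulC N g : normal_subgroup N -> mulset N [set g] = lcoset g N.
Proof.
move=> [_ NJ]; rewrite lcosetE; apply/seteqP; split => z /=.
  by case=> n Nn [_ -> <-]; have := NJ n g Nn; rewrite conjgE.
move=> Nz; exists (z * g^-1); last by exists g => //; rewrite mulgVK.
by have := NJ _ g^-1 Nz; rewrite conjgE invgK -mulgA mulVKg.
Qed.

Lemma lcosetM x y N : normal_subgroup N ->
  mulset (lcoset x N) (lcoset y N) = lcoset (x * y) N.
Proof.
move=> nN; rewrite -(normal_mulC x nN) -(normal_mulC y nN).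
rewrite -mulsetA (mulsetA [set x]) -/(lcoset x N) -(normal_mulC x nN).
rewrite !mulsetA (@mulsubK N N); [|by case: nN|by case: nN => -[]|by []].
by rewrite -mulsetA mulset1 normal_mulC.
Qed.

Lemma lcosetV x N : normal_subgroup N -> invset (lcoset x N) = lcoset x^-1 N.
Proof.
move=> nN; have [[N1 NM NV] NJ] := nN.
rewrite !lcosetE; apply/seteqP; split => z /=.
  case=> y /= Ny <-; rewrite invgK.
  by have := NJ _ x^-1 (NV _ Ny); rewrite conjgE !invgK invgM invgK mulgK.
rewrite invgK => Nz; exists z^-1; last by rewrite invgK.
rewrite /=; have := NJ _ x (NV _ Nz).
by rewrite conjgE invgM mulgVK.
Qed.

End Subsets.

Definition finitely_generated (G : groupType) :=
  exists s : seq G, forall H : set G,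
    subgroup H -> [set` s] `<=` H -> H = [set: G].

Definition renormalization (G : groupType) (phi : G -> G) :=
  [/\ {morph phi : x y / x * y}, injective phi,
      range phi != [set: G] & finite_index (range phi)].

Section Actions.
Context {X : topologicalType}.

Definition quasi_analytic (H : Type) (Phi : H -> X -> X) :=
  forall (U : set X) (g : H), clopen U -> U !=set0 ->
    Phi g @` U = U -> (forall x, U x -> Phi g x = x) -> forall x, Phi g x = x.

Definition homeo : set (X -> X) :=
  [set f | continuous f /\
    exists g : X -> X, [/\ continuous g, cancel f g & cancel g f]].

End Actions.

Section ProfiniteCompletion.
Variable G : groupType.

Definition fi_normal : set (set G) :=
  [set N | normal_subgroup N /\ finite_index N].

(* For N `<=` M, the quotient map G / N -> G / M sends the coset A to A * M. *)
Definition profinite_set :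
    set (prod_topology (fun N : fi_normal => discrete_topology (lcosets (val N)))) :=
  [set x | forall M N : fi_normal, val N `<=` val M ->
     val (x M) = mulset (val (x N)) (val M)].

Definition profinite_completion : Type := set_type profinite_set.
HB.instance Definition _ := Topological.on profinite_completion.

Implicit Types (x y z : profinite_completion) (N M : fi_normal).

Definition pcoord x N : set G := val (val x N).

Lemma pcoord_inj x y : (forall N, pcoord x N = pcoord y N) -> x = y.
Proof.
by move=> xy; apply/val_inj/functional_extensionality_dep => N; apply/val_inj/xy.
Qed.

Lemma pcoordP x N : lcosets (val N) (pcoord x N).
Proof. exact: set_valP. Qed.

Lemma pcoord_compat x M N : val N `<=` val M ->
  pcoord x M = mulset (pcoord x N) (val M).
Proof. exact: (set_valP x). Qed.

Lemma fi_normalP N : normal_subgroup (val N).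
Proof. by case: (set_valP N). Qed.

Lemma lcoset_compat g M N : val N `<=` val M ->
  lcoset g (val M) = mulset (lcoset g (val N)) (val M).
Proof.
move=> NM; have [sM _] := fi_normalP M; have [[N1 _ _] _] := fi_normalP N.
by rewrite /lcoset -mulsetA (@mulsubK _ (val N)).
Qed.

Section Build.
Variable f : fi_normal -> set G.
Hypothesis fP : forall N, lcosets (val N) (f N).
Hypothesis fC : forall M N, val N `<=` val M -> f M = mulset (f N) (val M).

Definition pbuild : profinite_completion :=
  exist _ ((fun N => exist _ (f N) (mem_set (fP N)))
    : prod_topology (fun N : fi_normal => discrete_topology (lcosets (val N))))
    (mem_set fC).

End Build.

Definition profinite_of (g : G) : profinite_completion :=
  @pbuild (fun N => lcoset g (val N)) (fun N => ex_intro2 _ _ g I erefl)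
    (lcoset_compat g).

Fact pmul_coset x y N : lcosets (val N) (mulset (pcoord x N) (pcoord y N)).
Proof.
case: (pcoordP x N) (pcoordP y N) => a _ <- [b _ <-].
by exists (a * b) => //; rewrite lcosetM//; exact: fi_normalP.
Qed.

Fact pmul_compat x y M N : val N `<=` val M ->
  mulset (pcoord x M) (pcoord y M) =
  mulset (mulset (pcoord x N) (pcoord y N)) (val M).
Proof.
move=> NM; rewrite (pcoord_compat x NM) (pcoord_compat y NM).
case: (pcoordP x N) (pcoordP y N) => a _ <- [b _ <-].
by rewrite -!lcoset_compat// !lcosetM -?lcoset_compat//; exact: fi_normalP.
Qed.

Fact pinv_coset x N : lcosets (val N) (invset (pcoord x N)).
Proof.
case: (pcoordP x N) => a _ <-.
by exists a^-1 => //; rewrite lcosetV//; exact: fi_normalP.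
Qed.

Fact pinv_compat x M N : val N `<=` val M ->
  invset (pcoord x M) = mulset (invset (pcoord x N)) (val M).
Proof.
move=> NM; rewrite (pcoord_compat x NM); case: (pcoordP x N) => a _ <-.
by rewrite -!lcoset_compat// !lcosetV -?lcoset_compat//; exact: fi_normalP.
Qed.

Definition pmul x y := pbuild (pmul_coset x y) (pmul_compat x y).
Definition pinv x := pbuild (pinv_coset x) (@pinv_compat x).
Definition pone := profinite_of 1.

Let pcoordE : (forall x y N, pcoord (pmul x y) N = mulset (pcoord x N) (pcoord y N))
  * (forall x N, pcoord (pinv x) N = invset (pcoord x N))
  * (forall N, pcoord pone N = lcoset 1 (val N)).
Proof. by []. Qed.

Fact pmulA : associative pmul.
Proof. by move=> x y z; apply: pcoord_inj => N; exact: mulsetA. Qed.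

Fact pmul1 : left_id pone pmul.
Proof.
move=> x; apply: pcoord_inj => N; rewrite !pcoordE.
case: (pcoordP x N) => a _ <-.
by rewrite lcosetM ?mul1g//; exact: fi_normalP.
Qed.

Fact pmulr1 : right_id pone pmul.
Proof.
move=> x; apply: pcoord_inj => N; rewrite !pcoordE.
case: (pcoordP x N) => a _ <-.
by rewrite lcosetM ?mulg1//; exact: fi_normalP.
Qed.

Fact pmulV : left_inverse pone pinv pmul.
Proof.
move=> x; apply: pcoord_inj => N; rewrite !pcoordE.
case: (pcoordP x N) => a _ <-.
by rewrite lcosetV ?lcosetM ?mulVg//; exact: fi_normalP.
Qed.

Fact pmulrV : right_inverse pone pinv pmul.
Proof.
move=> x; apply: pcoord_inj => N; rewrite !pcoordE.
case: (pcoordP x N) => a _ <-.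
by rewrite lcosetV ?lcosetM ?mulgV//; exact: fi_normalP.
Qed.

HB.instance Definition _ :=
  isGroup.Build profinite_completion pmulA pmul1 pmulr1 pmulV pmulrV.

Lemma pcoordM x y N : pcoord (x * y) N = mulset (pcoord x N) (pcoord y N).
Proof. by []. Qed.

Lemma pcoord_of g N : pcoord (profinite_of g) N = lcoset g (val N).
Proof. by []. Qed.

Lemma profinite_ofM : {morph profinite_of : g h / g * h}.
Proof.
move=> g h; apply: pcoord_inj => N.
by rewrite pcoordM !pcoord_of lcosetM//; exact: fi_normalP.
Qed.

End ProfiniteCompletion.

Arguments fi_normal G : clear implicits.
Arguments profinite_set G : clear implicits.
Arguments profinite_of {G} g.

Section CosetSpace.
Context {G : groupType}.
Variable phi : G -> G.

Definition Gl (l : nat) : set G := range (iter l phi).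

(* The quotient map G / Gl l.+1 -> G / Gl l sends the coset A to A * Gl l. *)
Definition Xphi_set :
    set (prod_topology (fun l => discrete_topology (lcosets (Gl l)))) :=
  [set x | forall l, val (x l) = mulset (val (x l.+1)) (Gl l)].

Definition Xphi : Type := set_type Xphi_set.
HB.instance Definition _ := Uniform.on Xphi.

Implicit Types x y : Xphi.

Definition xcoord x l : set G := val (val x l).

Lemma xcoord_inj x y : (forall l, xcoord x l = xcoord y l) -> x = y.
Proof.
by move=> xy; apply/val_inj/functional_extensionality_dep => l; apply/val_inj/xy.
Qed.

Lemma xcoordP x l : lcosets (Gl l) (xcoord x l).
Proof. exact: set_valP. Qed.

Lemma xcoord_compat x l : xcoord x l = mulset (xcoord x l.+1) (Gl l).
Proof. exact: (set_valP x). Qed.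

Section Build.
Variable f : nat -> set G.
Hypothesis fP : forall l, lcosets (Gl l) (f l).
Hypothesis fC : forall l, f l = mulset (f l.+1) (Gl l).

Definition xbuild : Xphi :=
  exist _ ((fun l => exist _ (f l) (mem_set (fP l)))
    : prod_topology (fun l => discrete_topology (lcosets (Gl l))))
    (mem_set fC).

End Build.

Fact act_compat g x l : mulset [set g] (xcoord x l) =
  mulset (mulset [set g] (xcoord x l.+1)) (Gl l).
Proof. by rewrite xcoord_compat mulsetA. Qed.

Definition Phi (g : G) (x : Xphi) : Xphi :=
  xbuild (fun l => mulset_lcosets g (xcoordP x l)) (act_compat g x).

Definition Gamma_hat : set {uniform Xphi -> Xphi} :=
  homeo `&` closure (range Phi : set {uniform Xphi -> Xphi}).

(* The group law of Gamma_hat is composition, and its topology is induced from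
   {uniform Xphi -> Xphi}, so that continuity can be tested in the latter. *)
Definition profinite_extension
    (Pi : profinite_completion G -> {uniform Xphi -> Xphi}) :=
  [/\ continuous Pi, forall a b, Pi (a * b) = Pi a \o Pi b,
      range Pi = Gamma_hat & forall g, Pi (profinite_of g) = Phi g].

End CosetSpace.

Arguments Gamma_hat {G} phi.
Arguments Xphi_set {G} phi.
Arguments Xphi {G} phi.
Arguments Gl {G} phi l.
Arguments Phi {G} phi g x.
Arguments profinite_extension {G} phi Pi.

Section FiniteIndex.
Context {G : groupType}.
Implicit Types (A B H N : set G) (g x y : G).

Lemma finite_indexP H : subgroup H -> finite_index H <->
  exists2 R : set G, finite_set R & forall g, exists2 r, R r & H (r^-1 * g).
Proof.
move=> sH; have [H1 HM HV] := sH; split=> [fH|[R fR RH]].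
  pose r (A : set G) := xget 1 A.
  exists (r @` lcosets H); first exact: finite_image.
  move=> g; exists (r (lcoset g H)); first by exists (lcoset g H) => //; exists g.
  have : lcoset g H (r (lcoset g H)).
    by apply: (@xgetPex _ 1); exists g; rewrite lcosetE/= mulVg.
  by rewrite lcosetE/= => /HV; rewrite invgM invgK.
apply: (@sub_finite_set _ _ (lcoset^~ H @` R)); last exact: finite_image.
by move=> _ [g _ <-]; have [r Rr /lcoset_eq-/(_ sH) E] := RH g; exists r.
Qed.

Lemma finite_index_fun (T : Type) (f : G -> T) N : subgroup N ->
  finite_set (range f) -> (forall x y, f x = f y -> N (x^-1 * y)) ->
  finite_index N.
Proof.
move=> sN ff fN.
pose r (t : T) := xget 1 [set g | f g = t].
apply/finite_indexP => //; exists (r @` range f); first exact: finite_image.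
move=> g; exists (r (f g)); first by exists (f g) => //; exists g.
by apply: fN; apply: (@xgetPex _ 1 [set h | f h = f g]); exists g.
Qed.

Lemma finite_range_map (T U : Type) (s : seq U) (f : U -> G -> T) :
  (forall u, finite_set (range (f u))) ->
  finite_set (range (fun g => [seq f u g | u <- s])).
Proof.
move=> ff; elim: s => [|u s IH].
  by apply: (@sub_finite_set _ _ [set [::]]) => // _ [g _ <-].
have := finite_image2 cons (ff u) IH.
apply: sub_finite_set => _ [g _ <-] /=.
by exists (f u g); [exists g|exists [seq f u g | u <- s]; [exists g|]].
Qed.

Definition fixer (L : set (set G)) : set G :=
  [set g | forall A, L A -> mulset [set g] A = A].

Lemma fixer_subgroup L : subgroup (fixer L).
Proof.
split=> [A LA|x y Lx Ly A LA|x Lx A LA].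
- exact: lcoset1.
- by rewrite -mulset1 -mulsetA Ly// Lx.
- by rewrite -{1}(Lx A LA) mulsetA mulset1 mulVg; exact: lcoset1.
Qed.

Lemma core_normal H : normal_subgroup (fixer (lcosets H)).
Proof.
split; first exact: fixer_subgroup.
move=> x g Lx A LA; rewrite conjgE -mulset1 -mulsetA -mulset1 -mulsetA Lx.
  by rewrite mulsetA mulset1 mulVg; exact: lcoset1.
exact: mulset_lcosets.
Qed.

Lemma core_finite H : finite_index H -> finite_index (fixer (lcosets H)).
Proof.
move=> fH; have [s sE] : exists s : seq (set G), lcosets H = [set` s].
  by apply/finite_seqP.
pose f (A : set G) (g : G) :=
  if pselect (lcosets H A) then mulset [set g] A else set0.
apply: (@finite_index_fun _ (fun g => [seq f A g | A <- s])).
- exact: fixer_subgroup.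
- apply: finite_range_map => A; rewrite /f; case: pselect => /= HA.
    apply: sub_finite_set fH => _ [g _ <-]; exact: mulset_lcosets.
  by apply: (@sub_finite_set _ _ [set set0]) => // _ [g _ <-].
- move=> x y xy A HA.
  have As : A \in s by move: (HA); rewrite sE.
  have := (eq_in_map _ _ _).2 xy _ As; rewrite /f; case: pselect => //= _ E.
  by rewrite -mulset1 -mulsetA -E mulsetA mulset1 mulVg; exact: lcoset1.
Qed.

Lemma setT_normal : normal_subgroup [set: G]. Proof. by []. Qed.

Lemma setI_normal N M : normal_subgroup N -> normal_subgroup M ->
  normal_subgroup (N `&` M).
Proof.
move=> [[N1 NM NV] NJ] [[M1 MM MV] MJ]; split; last first.
  by move=> x g [] /(NJ _ g) ? /(MJ _ g).
split => // [x y [Nx Mx] [Ny My]|x [Nx Mx]].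
  by split; [exact: NM|exact: MM].
by split; [exact: NV|exact: MV].
Qed.

Lemma finite_indexT : finite_index [set: G].
Proof.
have [sT _] := setT_normal; apply/finite_indexP => //.
by exists [set 1] => // g; exists 1.
Qed.

Lemma setI_finite_index N M : normal_subgroup N -> normal_subgroup M ->
  finite_index N -> finite_index M -> finite_index (N `&` M).
Proof.
move=> nN nM fN fM; have [sN _] := nN; have [sM _] := nM.
apply: (@finite_index_fun _ (fun g => (lcoset g N, lcoset g M))).
- by have [] := setI_normal nN nM.
- apply: sub_finite_set (finite_setX fN fM) => _ [g _ <-].
  by split; exists g.
- by move=> x y [/lcoset_eq-/(_ sN) ? /lcoset_eq-/(_ sM) ?].
Qed.

Lemma fi_bigcap (s : set (fi_normal G)) : finite_set s ->
  exists N : fi_normal G, forall M : fi_normal G, s M -> val N `<=` val M.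
Proof.
move=> /finite_seqP[r ->]; elim: r => [|M r [N IH]].
  have TP : fi_normal G setT by split; [exact: setT_normal|exact: finite_indexT].
  by exists (exist _ setT (mem_set TP)).
have [nN fN] := set_valP N; have [nM fM] := set_valP M.
have IP : fi_normal G (val N `&` val M).
  by split; [exact: setI_normal|exact: setI_finite_index].
exists (exist (fun K => K \in fi_normal G) _ (mem_set IP)) => K /=; rewrite inE => /orP[/eqP ->|/IH NK] x [] //.
by move=> /NK.
Qed.

End FiniteIndex.

Section Completion.
Context {G : groupType}.
Implicit Types (a b : profinite_completion G) (N : fi_normal G).

Lemma pcoord_nbhs a N : nbhs a [set b | pcoord b N = pcoord a N].
Proof.
have := @discrete_sub_coord_nbhs _ _ (profinite_set G) a N.
by apply: filterS => b E; exact: (congr1 val E).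
Qed.

Lemma profinite_of_rep a N : exists g, pcoord (profinite_of g) N = pcoord a N.
Proof. by have [g _ E] := pcoordP a N; exists g. Qed.

Lemma profinite_of_dense a (U : set (profinite_completion G)) :
  nbhs a U -> exists g, U (profinite_of g).
Proof.
move=> /(@discrete_sub_nbhs _ _ (profinite_set G)) [s fs sU].
have [N NM] := fi_bigcap fs; have [g gE] := profinite_of_rep a N.
exists g; apply: sU => M /NM {}NM; apply: val_inj.
by have := pcoord_compat (profinite_of g) NM; rewrite gE -(pcoord_compat a NM).
Qed.

End Completion.

Section Extension.
Context {G : groupType} (phi : G -> G).
Local Notation X := (Xphi phi).
Local Notation H := (Gl phi).
Implicit Types (x y : X) (a b : profinite_completion G).

Lemma xcoord_entourage l : entourage [set xy : X * X | xcoord xy.1 l = xcoord xy.2 l].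
Proof.
have := @discrete_sub_coord_entourage _ _ (Xphi_set phi) l.
apply: (@filterS _ _ (@entourage_filter X)) => -[x y] E.
exact: (congr1 val E).
Qed.

Lemma xcoord_nbhs x l : nbhs x [set y | xcoord y l = xcoord x l].
Proof.
have := @discrete_sub_coord_nbhs _ _ (Xphi_set phi) x l.
by apply: filterS => y E; exact: (congr1 val E).
Qed.

Hypothesis rphi : renormalization phi.

Let phiM : {morph phi : x y / x * y}. Proof. by case: rphi. Qed.

Lemma GlS l : H l.+1 = phi @` H l.
Proof.
apply/seteqP; split => z.
  by case=> g _ <-; exists (iter l phi g) => //; exists g.
by case=> _ [g _ <-] <-; exists g.
Qed.

Let phi1 : phi 1 = 1.
Proof. by apply: (mulgI (phi 1)); rewrite -phiM !mulg1. Qed.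

Let phiV g : phi g^-1 = (phi g)^-1.
Proof. by apply: (mulgI (phi g)); rewrite -phiM !mulgV phi1. Qed.

Lemma image_subgroup (K : set G) : subgroup K -> subgroup (phi @` K).
Proof.
move=> [K1 KM KV]; split; first by exists 1.
  by move=> _ _ [x Kx <-] [y Ky <-]; exists (x * y); [exact: KM|exact: phiM].
by move=> _ [x Kx <-]; exists x^-1; [exact: KV|exact: phiV].
Qed.

Lemma Gl_subgroup l : subgroup (H l).
Proof.
elim: l => [|l IH]; last by rewrite GlS; exact: image_subgroup.
suff -> : H 0 = setT by case: (@setT_normal G).
by apply/seteqP; split => // g _; exists g.
Qed.

Lemma Gl_finite_index l : finite_index (H l).
Proof.
have sT : subgroup (range phi).
  by apply: image_subgroup; case: (@setT_normal G).
elim: l => [|l /(finite_indexP (Gl_subgroup l))[R fR RH]].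
  suff -> : H 0 = setT by exact: finite_indexT.
  by apply/seteqP; split => // g _; exists g.
case: rphi => _ _ _ /(finite_indexP sT)[Q fQ QH].
apply/(finite_indexP (Gl_subgroup l.+1)).
exists [set q * phi r | q in Q & r in R]; first exact: finite_image2.
move=> g; have [q Qq [u _ uE]] := QH g; have [r Rr ru] := RH u.
exists (q * phi r); first by exists q => //; exists r.
rewrite GlS; exists (r^-1 * u) => //.
by rewrite phiM phiV uE invgM mulgA.
Qed.

Lemma core_fi_normal l : fi_normal G (fixer (lcosets (H l))).
Proof.
split; first exact: core_normal.
by apply: core_finite; exact: Gl_finite_index.
Qed.

Definition core l : fi_normal G :=
  exist (fun N => N \in fi_normal G) _ (mem_set (core_fi_normal l)).

Lemma sub_core l : val (core l.+1) `<=` val (core l).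
Proof.
move=> g gl A [h _ <-].
rewrite -(mulsubK (Gl_subgroup l) (H := H l.+1)).
- by rewrite /lcoset !mulsetA -(mulsetA [set g]) gl//; exists h.
- by case: (Gl_subgroup l.+1).
- by move=> _ [z _ <-]; exists (phi z) => //; rewrite iterSr.
Qed.

Lemma core_coset l A : lcosets (H l) A -> mulset (val (core l)) A = A.
Proof.
move=> HA; apply/seteqP; split => z.
  by case=> g gc [y Ay <-]; rewrite -(gc A HA); exists g => //; exists y.
by move=> Az; exists 1; [case: (fi_normalP (core l)) => -[]|exists z => //; rewrite mul1g].
Qed.

Lemma ext_act_rep a x l g : pcoord a (core l) = lcoset g (val (core l)) ->
  mulset (pcoord a (core l)) (xcoord x l) = mulset [set g] (xcoord x l).
Proof. by move=> ->; rewrite /lcoset -mulsetA core_coset//; exact: xcoordP. Qed.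

Lemma ext_act_coset a x l :
  lcosets (H l) (mulset (pcoord a (core l)) (xcoord x l)).
Proof.
have [g _ gE] := pcoordP a (core l); rewrite (@ext_act_rep _ _ _ g)//.
by apply: mulset_lcosets; exact: xcoordP.
Qed.

Lemma ext_act_compat a x l : mulset (pcoord a (core l)) (xcoord x l) =
  mulset (mulset (pcoord a (core l.+1)) (xcoord x l.+1)) (H l).
Proof.
have [g _ gE] := pcoordP a (core l.+1); rewrite (@ext_act_rep _ _ l.+1 g)//.
rewrite (@ext_act_rep _ _ l g); first by rewrite xcoord_compat mulsetA.
by rewrite (pcoord_compat a (@sub_core l)) -gE -lcoset_compat//; exact: sub_core.
Qed.

Definition ext_act a x : X := xbuild (ext_act_coset a x) (ext_act_compat a x).

Lemma xcoord_ext_act a x l :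
  xcoord (ext_act a x) l = mulset (pcoord a (core l)) (xcoord x l).
Proof. by []. Qed.

Lemma xcoord_Phi g x l : xcoord (Phi phi g x) l = mulset [set g] (xcoord x l).
Proof. by []. Qed.

Lemma ext_act_of g : ext_act (profinite_of g) = Phi phi g.
Proof.
apply/funext => x; apply: xcoord_inj => l.
by rewrite xcoord_ext_act xcoord_Phi (@ext_act_rep _ _ _ g).
Qed.

Lemma ext_actM a b : ext_act (a * b) = ext_act a \o ext_act b.
Proof.
by apply/funext => x; apply: xcoord_inj => l; rewrite !xcoord_ext_act pcoordM mulsetA.
Qed.

Lemma ext_act1 : ext_act 1 = id.
Proof.
rewrite -[1]/(profinite_of 1) ext_act_of; apply/funext => x.
by apply: xcoord_inj => l; exact: lcoset1.
Qed.

Lemma xcoord_le x y m n : (m <= n)%N -> xcoord x n = xcoord y n ->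
  xcoord x m = xcoord y m.
Proof.
elim: n => [|n IH]; first by rewrite leqn0 => /eqP ->.
rewrite leq_eqVlt ltnS => /orP[/eqP -> //|/IH{}IH E].
by apply: IH; rewrite (xcoord_compat x n) (xcoord_compat y n) E.
Qed.

Lemma finite_nat_ub (s : set nat) : finite_set s ->
  exists n, forall i, s i -> (i <= n)%N.
Proof.
move=> /finite_seqP[r ->]; exists (\max_(i <- r) i) => i /= ir.
exact: (@leq_bigmax_seq _ r xpredT id).
Qed.

Lemma Xphi_entourage (E : set (X * X)) : entourage E ->
  exists n, forall x y, xcoord x n = xcoord y n -> E (x, y).
Proof.
move=> /(@discrete_sub_entourage _ _ (Xphi_set phi))[s /finite_nat_ub[n sn] sE].
exists n => x y xy; apply: sE => i /sn {}ni; apply: val_inj.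
exact: xcoord_le xy.
Qed.

Lemma uniform_nbhs_coord (f : {uniform X -> X}) n :
  nbhs f [set h : {uniform X -> X} | forall x, xcoord (h x) n = xcoord (f x) n].
Proof.
apply/uniform_nbhs; exists [set xy : X * X | xcoord xy.1 n = xcoord xy.2 n].
by split; [exact: xcoord_entourage|move=> h /= fh x; rewrite fh].
Qed.

Lemma uniform_nbhsP (f : {uniform X -> X}) (U : set {uniform X -> X}) : nbhs f U ->
  exists n, forall h : X -> X,
    (forall x, xcoord (h x) n = xcoord (f x) n) -> U h.
Proof.
move=> /uniform_nbhs[E [/Xphi_entourage[n nE] EU]]; exists n => h hf.
by apply: EU => x _; apply: nE; rewrite hf.
Qed.

Lemma ext_act_nbhs a n : nbhs a
  [set b | forall x, xcoord (ext_act b x) n = xcoord (ext_act a x) n].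
Proof.
by apply: filterS (pcoord_nbhs a (core n)) => b E x; rewrite !xcoord_ext_act E.
Qed.

Lemma ext_act_continuous : continuous (ext_act : _ -> {uniform X -> X}).
Proof.
move=> a U /uniform_nbhsP[n nU].
by apply: filterS (ext_act_nbhs a n) => b E; exact: nU.
Qed.

Lemma ext_act_homeo a : homeo (ext_act a).
Proof.
have cpi b : continuous (ext_act b).
  move=> x U /(@nbhsP X)[E /Xphi_entourage[n nE] EU].
  apply: filterS (xcoord_nbhs (x : X) n) => y xy; apply: EU; apply/xsectionP.
  by apply: nE; rewrite !xcoord_ext_act xy.
split => //; exists (ext_act a^-1); split => // x.
  by rewrite -[LHS]/((ext_act a^-1 \o ext_act a) x) -ext_actM mulVg ext_act1.
by rewrite -[LHS]/((ext_act a \o ext_act a^-1) x) -ext_actM mulgV ext_act1.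
Qed.

Lemma closed_profinite_set : closed (profinite_set G).
Proof.
move=> p cp M N NM.
have cN := @discrete_prod_coord_entourage _ (fun N => set_type (lcosets (val N))) N.
have cM := @discrete_prod_coord_entourage _ (fun N => set_type (lcosets (val N))) M.
have [q [qS [/= Nq Mq]]] := cp _ (@filterI _ _ (nbhs_filter p) _ _
  (nbhs_entourage p cN) (nbhs_entourage p cM)).
move/xsectionP: Nq => /= ->; move/xsectionP: Mq => /= ->.
exact: qS.
Qed.

Lemma profinite_accumulation (g : nat -> G) : exists a,
  forall n N, exists2 m, (n <= m)%N & pcoord a N = lcoset (g m) (val N).
Proof.
pose P := prod_topology (fun N : fi_normal G => discrete_topology (lcosets (val N))).
have cP : compact [set: P].
  have := @tychonoff _ (fun N : fi_normal G => discrete_topology (lcosets (val N)))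
    (fun=> setT).
  rewrite (_ : [set f | _] = setT); last by apply/seteqP; split.
  apply => N; apply: finite_compact.
  have [_ fN] := set_valP N.
  by rewrite (eq_finite_set (card_setT _)).
have [p [_ clp]] := cP ((fun m => val (profinite_of (g m)) : P) @ \oo) _ filterT.
have pS : profinite_set G p.
  apply: closed_profinite_set; move: clp; rewrite clusterE; apply.
  by exists 0%N => // m _; exact: (set_valP (profinite_of (g m))).
exists (exist (fun q => q \in profinite_set G) p (mem_set pS)) => n N.
have [] := clp [set val (profinite_of (g m)) | m in [set m | (n <= m)%N]]
  (xsection [set xy : P * P | xy.1 N = xy.2 N] p).
- by exists n => // m /= nm; exists m.
- exact: (nbhs_entourage _ (@discrete_prod_coord_entourage _ (fun N => set_type (lcosets (val N))) N)).
- move=> _ [[m nm <-] /xsectionP /= E]; exists m => //.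
  exact: (congr1 val E).
Qed.

Lemma ext_act_range : range ext_act = Gamma_hat phi.
Proof.
apply/seteqP; split => [_ [a _ <-]|f [_ cf]].
  split; first exact: ext_act_homeo.
  move=> U /ext_act_continuous /profinite_of_dense[g Ug].
  by exists (Phi phi g); split; [exists g|rewrite -ext_act_of].
have /choice[g gf] n : exists g, forall x, xcoord (f x) n = xcoord (Phi phi g x) n.
  have [_ [[g _ <-] gf]] := cf _ (uniform_nbhs_coord f n).
  by exists g => x; rewrite gf.
have [a aP] := profinite_accumulation g.
exists a => //; apply/funext => x; apply: xcoord_inj => n.
have [m nm am] := aP n (core n).
by rewrite xcoord_ext_act (@ext_act_rep _ _ _ (g m))// -xcoord_Phi; apply/esym/(xcoord_le nm).
Qed.

Lemma ext_act_extension : profinite_extension phi (ext_act : _ -> {uniform X -> X}).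
Proof.
split; [exact: ext_act_continuous|exact: ext_actM|exact: ext_act_range|exact: ext_act_of].
Qed.

Lemma profinite_extension_unique (Pi Pi' : profinite_completion G -> {uniform X -> X}) :
  profinite_extension phi Pi -> profinite_extension phi Pi' -> Pi = Pi'.
Proof.
move=> [cP _ _ oP] [cP' _ _ oP']; apply/funext => a; apply/funext => x.
apply: xcoord_inj => n.
have [g [gE gE']] := profinite_of_dense (@filterI _ _ (nbhs_filter a) _ _
  (cP a _ (uniform_nbhs_coord (Pi a) n)) (cP' a _ (uniform_nbhs_coord (Pi' a) n))).
by rewrite -gE -gE' oP oP'.
Qed.

Lemma profinite_extension_exists : exists Pi, profinite_extension phi Pi.
Proof. by exists ext_act; exact: ext_act_extension. Qed.

Definition Pi_phi : profinite_completion G -> {uniform X -> X} :=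
  projT1 (cid profinite_extension_exists).

Lemma Pi_phiP : profinite_extension phi Pi_phi.
Proof. exact: projT2 (cid profinite_extension_exists). Qed.

Lemma Pi_phiE : Pi_phi = ext_act.
Proof. exact: profinite_extension_unique Pi_phiP ext_act_extension. Qed.

Definition profinite_action (a : profinite_completion G) (x : X) : X := Pi_phi a x.

End Extension.

(* Main.v *)
Require Import Defs.
From mathcomp Require Import all_boot all_classical topology.
From mathcomp Require Import finmap.

(** Write H_l for the image of phi^l and C_l for its normal core, which is the
kernel of the action of G on G / H_l. An element a of the completion that fixes
a nonempty clopen set pointwise fixes the cylinder of some coset h H_m, and
after conjugation by h it fixes the cylinder of H_m. For each l an element g of
G acts on G / H_(m + l) as a does, so g fixes every coset x H_(m + l) with x in
H_m. Injectivity of phi then gives g = phi^m k with k in C_l ([fixing_iter]):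
the action of H_m on H_m / H_(m + l) is a copy, through phi^m, of the action of
G on G / H_l. It remains to see that, for fixed n and for l large, phi^m maps
C_l into C_n for all m ([core_iter_sub]); then g, hence a, is trivial on
G / H_n, and n is arbitrary.

This last point is where finite generation enters. There are finitely many
homomorphisms from G to the finite group G / C_n, so their common kernel M has
finite index; M lies in C_n, and phi maps M into M because a homomorphism
to G / C_n composed with phi is again one ([common_kernel_stable]). Hence phi induces an
endomorphism f of the finite group G / M. Let P_l be the image of C_l in G / M.
The case m = 1 above gives C_(l+1) <= phi C_l, so P_(l+1) is contained both in
P_l and in f P_l. The cardinality of P_l is eventually constant, and f P_l has
no more elements than P_l, so f P_l = P_(l+1) = P_l for large l
([descent_stable]). Therefore phi^m C_l is contained in C_l M, thus in C_n.

This says that if K is the kernel of the action of the completion and F the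
continuous extension of phi to it, the inclusion K <= F K is an equality, since
it is one in each of the finite quotients by an invariant open subgroup; the
proof works with these quotients only and does not construct F. *)

Set Implicit Arguments.
Unset Strict Implicit.
Unset Printing Implicit Defensive.

Local Open Scope classical_set_scope.
Local Open Scope group_scope.

(** * Descending sequences of finite sets *)

(** Applying f cannot increase the cardinality of P l, and shrinking P l to
P l.+1 cannot decrease it once it is minimal; so both inclusions of P l.+1
become equalities. *)
Lemma descent_stable (T : choiceType) (P : nat -> set T) (f : T -> T) :
  (forall l, finite_set (P l)) -> (forall l, P l.+1 `<=` P l) ->
  (forall l, P l.+1 `<=` f @` P l) ->
  exists L, forall l, (L <= l)%N -> f @` P l `<=` P l.
Proof.
move=> fP decrP subfP; pose c l := #|` fset_set (P l)|.
have c_decr : {homo c : m n / (m <= n)%N >-> (n <= m)%N}.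
  apply: (homo_leq (r := fun a b => (b <= a)%N)) => // [y x z yx zy|l].
    exact: leq_trans yx.
  by apply: fsubset_leq_card; have := decrP l; rewrite fset_set_sub.
have [_ [[L _ <-] cmin]] : exists n, range c n /\ forall k, (k < n)%N -> ~ range c k.
  have ex : exists n, `[< range c n >] by exists (c 0%N); apply/asboolP; exists 0%N.
  case: (ex_minnP ex) => n /asboolP cn nmin; exists n; split => // k kn ck.
  by have := nmin k (asboolT ck); rewrite leqNgt kn.
exists L => l Ll; suff -> : f @` P l = P l.+1 by exact: decrP.
apply: fset_set_inj => //; first exact: finite_image.
apply/esym/eqP; rewrite eqEfcard; apply/andP; split.
  by have := subfP l; rewrite fset_set_sub//; exact: finite_image.
rewrite (fset_set_image f (fP l)).
apply: (leq_trans (leq_imfset_card _ _ _)).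
apply: (leq_trans (c_decr _ _ Ll)); rewrite leqNgt; apply/negP => /cmin.
by apply; exists l.+1.
Qed.

(** * The common kernel of the homomorphisms to a finite quotient *)

Section CosetHom.
Context {G : groupType}.
Variable N : set G.
Hypothesis nN : normal_subgroup N.
Implicit Types (f h : G -> set G) (x y : G).

(** The homomorphisms from G to G / N, where the elements of G / N are
represented by the cosets themselves, with their product as sets. *)
Definition coset_hom : set (G -> set G) := [set f |
  (forall x, lcosets N (f x)) /\ {morph f : x y / x * y >-> mulset x y}].

Definition common_kernel : set G := [set g | forall f, coset_hom f -> f g = N].

Let sN : subgroup N. Proof. by case: nN. Qed.

Lemma mul1coset A : lcosets N A -> mulset N A = A.
Proof. by case=> a _ <-; rewrite -{1}(lcoset1 N) lcosetM// mul1g. Qed.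

Lemma mulcoset1 A : lcosets N A -> mulset A N = A.
Proof. by case=> a _ <-; rewrite -{2}(lcoset1 N) lcosetM// mulg1. Qed.

Lemma coset_hom1 f : coset_hom f -> f 1 = N.
Proof.
case=> fN fM; have [a _ fa] := fN 1; have := fM 1 1; rewrite mulg1 -fa lcosetM//.
move=> /lcoset_eq-/(_ sN); rewrite mulKg => Na.
by rewrite -[RHS]lcoset1; apply/esym/lcoset_eq; rewrite // invg1 mul1g.
Qed.

Lemma coset_hom_eq f x y : coset_hom f -> f x = f y -> f (x^-1 * y) = N.
Proof. by move=> fH fxy; rewrite fH.2 -fxy -fH.2 mulVg coset_hom1. Qed.

(** Together with finite generation, this shows that a homomorphism to G / N is
determined by its values on the generators. *)
Lemma equalizer_subgroup f h : coset_hom f -> coset_hom h ->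
  subgroup [set x | f x = h x].
Proof.
move=> fH hH; split=> /= [|x y fx fy|x fx]; first by rewrite !coset_hom1.
  by rewrite fH.2 hH.2 fx fy.
rewrite -(mulcoset1 (fH.1 _)) -(coset_hom1 hH) -(mulgV x) hH.2 mulsetA -fx.
by rewrite -fH.2 mulVg coset_hom1// mul1coset//; exact: hH.1.
Qed.

Lemma coset_hom_comp f (phi : G -> G) : {morph phi : x y / x * y} ->
  coset_hom f -> coset_hom (f \o phi).
Proof. by move=> phiM fH; split=> [x|x y] /=; [exact: fH.1|rewrite phiM fH.2]. Qed.

(** The quotient map; it is the reason why the common kernel lies in N. *)
Lemma coset_hom_lcoset : coset_hom (lcoset^~ N).
Proof. by split=> [x|x y]; [exists x|rewrite lcosetM]. Qed.

Lemma common_kernel_sub : common_kernel `<=` N.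
Proof.
move=> g /(_ _ coset_hom_lcoset); rewrite -[RHS]lcoset1 => /esym/lcoset_eq.
by move=> /(_ sN); rewrite invg1 mul1g.
Qed.

Lemma common_kernel_normal : normal_subgroup common_kernel.
Proof.
have NN : mulset N N = N by apply: mul1coset; exists 1 => //; exact: lcoset1.
split; first split.
- by move=> f; exact: coset_hom1.
- by move=> x y Kx Ky f fH; rewrite fH.2 Kx// Ky.
- move=> x Kx f fH; rewrite -(mulg1 x^-1); apply: coset_hom_eq => //.
  by rewrite coset_hom1// Kx.
- move=> x g Kx f fH; rewrite conjgE fH.2 fH.2 (Kx _ fH).
  by rewrite mul1coset// -?fH.2 ?mulVg ?coset_hom1//; exact: fH.1.
Qed.

(** The property for which the common kernel is used in place of N, which phi
need not preserve: the homomorphisms to G / N are closed under composition with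
phi on the right. *)
Lemma common_kernel_stable (phi : G -> G) : {morph phi : x y / x * y} ->
  phi @` common_kernel `<=` common_kernel.
Proof. by move=> phiM _ [x Kx <-] f /(coset_hom_comp phiM); exact: Kx. Qed.

Lemma finite_coset_hom : finitely_generated G -> finite_index N ->
  finite_set coset_hom.
Proof.
move=> [s sG] fN; pose ev f := [seq f u | u <- s].
have fev t : finite_set [set [seq f u | u <- t] | f in coset_hom].
  elim: t => [|u t IH].
    by apply: (@sub_finite_set _ _ [set [::]]) => // _ [f _ <-].
  apply: sub_finite_set (finite_image2 cons fN IH) => _ [f fH <-] /=.
  by exists (f u); [exact: fH.1|exists [seq f u | u <- t] => //; exists f].
rewrite -(eq_finite_set (@inj_card_eq _ _ coset_hom ev _)); first exact: fev.
move=> f h /set_mem fH /set_mem hH /eq_in_map fh; apply/funext => x.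
have E := sG _ (equalizer_subgroup fH hH) fh.
by suff : [set x | f x = h x] x by []; rewrite E.
Qed.

Lemma common_kernel_finite : finitely_generated G -> finite_index N ->
  finite_index common_kernel.
Proof.
move=> Gfg fN; have /finite_seqP[r rE] := finite_coset_hom Gfg fN.
(* The default value N makes ev f take finitely many values also when f is not
   a homomorphism. *)
pose ev f g := if f \in coset_hom then f g else N.
apply: (@finite_index_fun _ _ (fun g => [seq ev f g | f <- r])).
- by case: common_kernel_normal.
- apply: finite_range_map => f.
  have [fH|fH] := boolP (f \in coset_hom).
    by apply: sub_finite_set fN => _ [g _ <-]; rewrite /ev fH; exact: (set_mem fH).1.
  by apply: (@sub_finite_set _ _ [set N]) => // _ [g _ <-]; rewrite /ev (negbTE fH).
- move=> x y /eq_in_map xy f fH; apply: coset_hom_eq => //.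
  have fr : f \in r by move: (fH); rewrite rE.
  by have := xy f fr; rewrite /ev mem_set.
Qed.

End CosetHom.

(** * The cores of the subgroups of the tower *)

Section Descent.
Context {G : groupType} (phi : G -> G).
Hypothesis rphi : renormalization phi.
Local Notation H := (Gl phi).
Local Notation core := (core rphi).

Let phiM : {morph phi : x y / x * y}. Proof. by case: rphi. Qed.

Let phi_inj : injective phi. Proof. by case: rphi. Qed.

Lemma iter_inj m : injective (iter m phi).
Proof. by elim: m => //= m IH x y /phi_inj/IH. Qed.

Lemma iterM m : {morph iter m phi : x y / x * y}.
Proof. by elim: m => [|m IH] x y; rewrite ?iterS ?IH ?phiM. Qed.

Lemma iter1 m : iter m phi 1 = 1.
Proof. by apply: (mulgI (iter m phi 1)); rewrite -iterM !mulg1. Qed.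

Lemma iterV m x : iter m phi x^-1 = (iter m phi x)^-1.
Proof. by apply: (mulgI (iter m phi x)); rewrite -iterM !mulgV iter1. Qed.

Lemma image_lcoset g (A : set G) : phi @` lcoset g A = lcoset (phi g) (phi @` A).
Proof.
apply/seteqP; split=> [_ [_ [_ -> [x Ax <-]] <-]|_ [_ -> [_ [x Ax <-] <-]]].
  by exists (phi g) => //; exists (phi x); [exists x|rewrite phiM].
by exists (g * x); [exists g => //; exists x|rewrite phiM].
Qed.

Lemma Gl_iter m l x : H (m + l) (iter m phi x) -> H l x.
Proof. by case=> y _; rewrite iterD => /iter_inj <-; exists y. Qed.

Lemma GlD m l : H (m + l) `<=` H m.
Proof. by move=> _ [y _ <-]; rewrite iterD; exists (iter l phi y). Qed.

Lemma coreP l g : val (core l) g <-> forall x, H l (x^-1 * (g * x)).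
Proof.
have sl := Gl_subgroup rphi l; rewrite -[val (core l) g]/(fixer (lcosets (H l)) g).
split=> [gl x|gl A [x _ <-]].
  have := gl (lcoset x (H l)); rewrite /lcoset mulsetA mulset1 => E.
  by apply/(lcoset_eq _ _ sl); rewrite /lcoset E//; exists x.
by rewrite /lcoset mulsetA mulset1; apply/esym/(lcoset_eq _ _ sl).
Qed.

Lemma sub_coreD l n : val (core (l + n)) `<=` val (core l).
Proof.
elim: n => [|n IH]; first by rewrite addn0.
by rewrite addnS => g /sub_core/IH.
Qed.

(** Taking x = 1 shows that g lies in the image of phi^m. The map phi^m then
identifies G / Gl l with Gl m / Gl (m + l), and the action of k on the former
with the action of g on the latter. *)
Lemma fixing_iter m l g : (forall x, H m x -> H (m + l) (x^-1 * (g * x))) ->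
  exists2 k, val (core l) k & iter m phi k = g.
Proof.
move=> gfix; have [H1 _ _] := Gl_subgroup rphi m.
have := gfix 1 H1; rewrite invg1 mul1g mulg1 => /GlD[k _ kg].
exists k => //; apply/coreP => x; apply: (@Gl_iter m).
by rewrite !iterM iterV kg; apply: gfix; exists x.
Qed.

Lemma core_sub_image l : val (core l.+1) `<=` phi @` val (core l).
Proof.
move=> g /coreP gl; have [k kl <-] : exists2 k, val (core l) k & iter 1 phi k = g.
  by apply: fixing_iter => x _; exact: gl.
by exists k.
Qed.

(** The cores are normal but need not be preserved by phi; far enough in the
tower they are, modulo an invariant subgroup of finite index contained in the
target. The bound L must not depend on m. *)
Lemma core_iter_sub n : finitely_generated G ->
  exists L, forall m, iter m phi @` val (core L) `<=` val (core n).
Proof.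
move=> Gfg; have [nN fN] := set_valP (core n).
pose M := common_kernel (val (core n)).
have nM : normal_subgroup M by exact: common_kernel_normal.
have fM : finite_index M by exact: common_kernel_finite.
have [sM _] := nM; have [M1 MM MV] := sM.
pose P l := lcoset^~ M @` val (core l).
(* The endomorphism of G / M induced by phi. *)
pose f A := mulset (phi @` A) M.
have fE g : f (lcoset g M) = lcoset (phi g) M.
  rewrite /f image_lcoset /lcoset -mulsetA (@mulsubK _ (phi @` M))//.
    by exists 1; [exact: M1|exact: (iter1 1)].
  exact: common_kernel_stable.
have [L LP] : exists L, forall l, (L <= l)%N -> f @` P l `<=` P l.
  apply: descent_stable => l.
  - by apply: sub_finite_set fM => _ [g _ <-]; exists g.
  - by move=> _ [g /sub_core gl <-]; exists g.
  - move=> _ [_ /core_sub_image[k kl <-] <-].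
    by exists (lcoset k M); [exists k|].
(* Adding n puts the core of level n + L inside the one of level n. *)
exists (n + L)%N => m.
have inP g : P (n + L)%N (lcoset g M) -> val (core n) g.
  case=> k /sub_coreD kn /(lcoset_eq _ _ sM) /(common_kernel_sub nN) kg.
  by have [[_ NM _] _] := nN; rewrite -(mulVKg k g); exact: NM.
suff step g : val (core (n + L)) g -> P (n + L)%N (lcoset (iter m phi g) M).
  by move=> _ [g /step/inP gn <-].
move=> gl; elim: m => [|m IH] /=; first by exists g.
by rewrite -fE; apply: (LP _ (leq_addl _ _)); exists (lcoset (iter m phi g) M).
Qed.

(** Quasi-analyticity at a finite level: triviality of g on the part of
G / Gl (m + l) above the base coset of level m, for l large, implies triviality
on the whole of G / Gl n. *)
Lemma germ_trivial m n : finitely_generated G -> exists l, forall g,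
  (forall x, H m x -> H (m + l) (x^-1 * (g * x))) -> val (core n) g.
Proof.
move=> Gfg; have [L LP] := core_iter_sub n Gfg; exists L => g /fixing_iter[k kL <-].
by apply: (LP m); exists k.
Qed.

(** * The action on the inverse limit *)

Lemma basepoint_lcosets l : lcosets (H l) (H l).
Proof. by exists 1 => //; exact: lcoset1. Qed.

Lemma basepoint_compat l : H l = mulset (H l.+1) (H l).
Proof.
have [H1 _ _] := Gl_subgroup rphi l.+1; rewrite mulsubK//; first exact: Gl_subgroup.
by rewrite -addn1; exact: GlD.
Qed.

(** The orbit of the coherent sequence of trivial cosets suffices to test the
action: its coordinates at level l run over all of G / Gl l. *)
Definition basepoint : Xphi phi := xbuild basepoint_lcosets basepoint_compat.

Lemma xcoord_orbit g l : xcoord (Phi phi g basepoint) l = lcoset g (H l).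
Proof. by []. Qed.

Lemma ext_act_approx (a : profinite_completion G) n : exists g, forall x k,
  (k <= n)%N -> xcoord (ext_act rphi a x) k = xcoord (Phi phi g x) k.
Proof.
have [g gE] := profinite_of_rep a (core n); exists g => x k kn.
by apply: (xcoord_le kn); rewrite -(ext_act_of rphi) !xcoord_ext_act gE.
Qed.

(** At a finite level b acts as an element g of G, to which [germ_trivial]
applies. The level n + l + k is chosen to be above n + l, where the hypothesis
on b is used, and above k, where the conclusion is needed. *)
Lemma cylinder_faithful (b : profinite_completion G) n : finitely_generated G ->
  (forall x, H n x -> ext_act rphi b (Phi phi x basepoint) = Phi phi x basepoint) ->
  ext_act rphi b = id.
Proof.
move=> Gfg bfix; apply/funext => x; apply: xcoord_inj => k.
have [l lP] := germ_trivial n k Gfg.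
have [g gE] := ext_act_approx b (n + l + k).
rewrite gE ?leq_addl// xcoord_Phi.
suff gk : val (core k) g by apply: gk; exact: xcoordP.
apply: lP => y Hy; have sH := Gl_subgroup rphi (n + l).
apply/(lcoset_eq _ _ sH); rewrite -[LHS]xcoord_orbit -{1}(bfix y Hy).
by rewrite gE ?leq_addr// xcoord_Phi xcoord_orbit /lcoset mulsetA mulset1.
Qed.

Lemma nbhs_cylinder (u : Xphi phi) (U : set (Xphi phi)) : nbhs u U ->
  exists n, forall x, xcoord x n = xcoord u n -> U x.
Proof.
move=> /(@nbhsP (Xphi phi))[E /Xphi_entourage[n nE] EU]; exists n => x xu.
by apply: EU; apply/xsectionP; exact: nE.
Qed.

End Descent.

Theorem theorem4p4 (G : groupType) (phi : G -> G)
    (hG : finitely_generated G) (hphi : renormalization phi) :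
  quasi_analytic (profinite_action hphi).
Proof.
rewrite (_ : profinite_action hphi = ext_act hphi); last first.
  by apply/funext => a; rewrite -(Pi_phiE hphi).
move=> U a [oU _] [u Uu] _ afix.
have [n nU] := nbhs_cylinder (open_nbhs_nbhs (conj oU Uu)).
(* Conjugation by h moves the cylinder of level n around u to the one around
   the base point. *)
have [h _ uh] := xcoordP u n.
pose t := profinite_of h; pose b := t^-1 * a * t.
have btriv : ext_act hphi b = id.
  apply: (cylinder_faithful (n := n)) => // x Hx.
  have htU : U (ext_act hphi t (Phi phi x (basepoint hphi))).
    apply: nU; rewrite ext_act_of xcoord_Phi xcoord_orbit -uh.
    rewrite /lcoset mulsetA mulset1; apply/(lcoset_eq _ _ (Gl_subgroup hphi n)).
    have [_ _ HV] := Gl_subgroup hphi n.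
    by rewrite invgM mulgVK; exact: HV.
  rewrite /b !ext_actM /= (afix _ htU).
  rewrite -[LHS]/((ext_act hphi t^-1 \o ext_act hphi t) _).
  by rewrite -ext_actM mulVg ext_act1.
have -> : a = t * b * t^-1 by rewrite /b !mulgA mulgV mul1g mulgK.
move=> x; rewrite (ext_actM hphi (t * b)) (ext_actM hphi t b) btriv.
rewrite -[LHS]/((ext_act hphi t \o ext_act hphi t^-1) x).
by rewrite -ext_actM mulgV ext_act1.
Qed.
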